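(* Let $G$ and $H$ be countable discrete groups and let $G\curvearrowright X$ and $H\curvearrowright Y$ be topologically free topological dynamical systems on locally compact Hausdorff spaces. There exists a continuous orbit couple $(p,q)$, $p: X\to Y$, $q: Y\to X$, for $G\curvearrowright X$ and $H\curvearrowright Y$ with $p(X)$ closed in $Y$ if and only if $G\curvearrowright X$ and $H\curvearrowright Y$ are Kakutani equivalent.
   Context: A topological dynamical system $G\curvearrowright X$ is an action by homeomorphisms on a locally compact Hausdorff space, written $g.x$; it is topologically free if for every $g\neq e$ the set $\{x : g.x\neq x\}$ is dense. A continuous map $p: X\to Y$ is a continuous orbit map if there is a continuous $a: G\times X\to H$ with $p(g.x)=a(g,x).p(x)$ for all $g\in G,x\in X$. A continuous orbit couple for $G\curvearrowright X$ and $H\curvearrowright Y$ consists of continuous orbit maps $p: X\to Y$, $q: Y\to X$ such that there are continuous maps $g: X\to G$, $h: Y\to H$ with $q(p(x))=g(x).x$ and $p(q(y))=h(y).y$ for all $x\in X$, $y\in Y$. The transformation groupoid $X\rtimes G$ is $X\times G$ with $r(x,g)=x$, $s(x,g)=g^{-1}.x$, $(x,g)(g^{-1}.x,g')=(x,gg')$; for $A\subseteq X$, $(X\rtimes G)|A=s^{-1}(A)\cap r^{-1}(A)$. $G\curvearrowright X$ and $H\curvearrowright Y$ are Kakutani equivalent if there exist clopen $A\subseteq X$, $B\subseteq Y$ with $G.A=X$, $H.B=Y$ and $(X\rtimes G)|A\cong(Y\rtimes H)|B$ as topological groupoids. *)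

(* Defs.v *)
From HB Require Import structures.
From mathcomp Require Import all_boot all_order all_algebra.
From mathcomp Require Import all_classical all_reals all_analysis.

Set Implicit Arguments.
Unset Strict Implicit.
Unset Printing Implicit Defensive.

Local Open Scope classical_set_scope.
Local Open Scope group_scope.

#[short(type="discreteGroupType")]
HB.structure Definition DiscreteGroup := {G of Group G & DiscreteTopology G}.

(* Each [act g] is a homeomorphism, with inverse [act g^-1]. *)
Record dynSystem (G : groupType) (X : topologicalType) := DynSystem {
  act :> G -> X -> X;
  act1 : forall x, act 1 x = x;
  actM : forall g g' x, act (g * g') x = act g (act g' x);
  act_continuous : forall g, continuous (act g);
  dyn_locally_compact : locally_compact [set: X];
  dyn_hausdorff : hausdorff_space X
}.

Definition topologically_free (G : groupType) (X : topologicalType)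
    (alpha : dynSystem G X) : Prop :=
  forall g : G, g <> 1 -> dense [set x : X | alpha g x <> x].

Definition continuous_orbit_map (G H : discreteGroupType)
    (X Y : topologicalType) (alpha : dynSystem G X) (beta : dynSystem H Y)
    (p : X -> Y) : Prop :=
  continuous p /\
  exists a : G * X -> H, continuous a /\
    forall (g : G) (x : X), p (alpha g x) = beta (a (g, x)) (p x).

Definition continuous_orbit_couple (G H : discreteGroupType)
    (X Y : topologicalType) (alpha : dynSystem G X) (beta : dynSystem H Y)
    (p : X -> Y) (q : Y -> X) : Prop :=
  [/\ continuous_orbit_map alpha beta p,
      continuous_orbit_map beta alpha q,
      exists g : X -> G, continuous g /\ forall x, q (p x) = alpha (g x) x &
      exists h : Y -> H, continuous h /\ forall y, p (q y) = beta (h y) y].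

Definition homeomorphism (X Y : topologicalType) (f : X -> Y) : Prop :=
  exists f' : Y -> X,
    [/\ cancel f f', cancel f' f, continuous f & continuous f'].

(* The product [gmul a b _] is only defined on composable pairs, those with
   [gsrc a = grng b]. The unit space is a separate type [gobj], embedded in the
   arrows by [gone]. *)
Record topGroupoid := TopGroupoid {
  gobj : topologicalType;
  garr : topologicalType;
  grng : garr -> gobj;
  gsrc : garr -> gobj;
  gone : gobj -> garr;
  ginv : garr -> garr;
  gmul : forall a b : garr, gsrc a = grng b -> garr;
  grng_one : forall x, grng (gone x) = x;
  gsrc_one : forall x, gsrc (gone x) = x;
  grng_inv : forall a, grng (ginv a) = gsrc a;
  gsrc_inv : forall a, gsrc (ginv a) = grng a;
  grng_mul : forall a b (ab : gsrc a = grng b), grng (gmul ab) = grng a;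
  gsrc_mul : forall a b (ab : gsrc a = grng b), gsrc (gmul ab) = gsrc b;
  gmulA : forall a b c (ab : gsrc a = grng b) (bc : gsrc b = grng c)
      (a_bc : gsrc a = grng (gmul bc)) (ab_c : gsrc (gmul ab) = grng c),
    gmul a_bc = gmul ab_c;
  gmul1 : forall a (e : gsrc a = grng (gone (gsrc a))), gmul e = a;
  g1mul : forall a (e : gsrc (gone (grng a)) = grng a), gmul e = a;
  gmulV : forall a (e : gsrc a = grng (ginv a)), gmul e = gone (grng a);
  gVmul : forall a (e : gsrc (ginv a) = grng a), gmul e = gone (gsrc a);
  grng_continuous : continuous grng;
  gsrc_continuous : continuous gsrc;
  gone_continuous : continuous gone;
  ginv_continuous : continuous ginv;
  gmul_continuous : continuous
    (fun ab : [set ab : garr * garr | gsrc ab.1 = grng ab.2] =>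
       gmul (set_valP ab))
}.

(* The hypothesis [phi_ab] follows from the first two clauses; it is quantified
   only because [gmul] takes a composability proof. *)
Definition groupoid_morphism (Gam Del : topGroupoid)
    (phi : garr Gam -> garr Del) (phi0 : gobj Gam -> gobj Del) : Prop :=
  [/\ forall a, grng (phi a) = phi0 (grng a),
      forall a, gsrc (phi a) = phi0 (gsrc a),
      forall x, phi (gone x) = gone (phi0 x) &
      forall a b (ab : gsrc a = grng b) (phi_ab : gsrc (phi a) = grng (phi b)),
        phi (gmul ab) = gmul phi_ab].

(* The inverse of a bijective morphism is again a morphism. *)
Definition topGroupoid_isomorphic (Gam Del : topGroupoid) : Prop :=
  exists (phi : garr Gam -> garr Del) (phi0 : gobj Gam -> gobj Del),
    [/\ homeomorphism phi, homeomorphism phi0 & groupoid_morphism phi phi0].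

Section continuity.

Lemma continuous_set_val (X : topologicalType) (A : set X) :
  continuous (set_val : A -> X).
Proof. exact: initial_continuous. Qed.

Lemma continuous_to_subtype (X Y : topologicalType) (B : set Y) (f : X -> B) :
  continuous (fun x => set_val (f x)) -> continuous f.
Proof.
move=> cf x U; rewrite /= /nbhs /= => -[_ [[V oV <-] Vx VU]].
have : \forall x' \near x, V (set_val (f x')).
  by apply: cf; exact: open_nbhs_nbhs.
by apply: filterS => x' Vx'; exact: VU.
Qed.

Lemma continuous_from_discrete (D : discreteTopologicalType)
  (Y : topologicalType) (f : D -> Y) : continuous f.
Proof.
move=> d U /nbhs_singleton fU.
by apply: filterS (discrete_set1 d) => _ ->.
Qed.

Lemma continuous_prod_discrete (X Y : topologicalType)
    (D : discreteTopologicalType) (f : X * D -> Y) :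
  (forall d, continuous (fun x => f (x, d))) -> continuous f.
Proof.
move=> cf [x d] U fU; have {}cf := cf d x U fU.
exists ([set x' | U (f (x', d))], [set d]) => /=.
  by split=> //; exact: discrete_set1.
by case=> x' d' /= [? ->].
Qed.

End continuity.

Module Transformation.
Section transformation.
Context (G : discreteGroupType) (X : topologicalType) (alpha : dynSystem G X).
Definition arr : topologicalType := (X * G)%type.
Definition rng (a : arr) : X := a.1.
Definition src (a : arr) : X := alpha a.2^-1 a.1.
Definition one (x : X) : arr := (x, 1).
Definition inv (a : arr) : arr := (alpha a.2^-1 a.1, a.2^-1).
Definition mul (a b : arr) (_ : src a = rng b) : arr := (a.1, a.2 * b.2).

Lemma src_one x : src (one x) = x.
Proof. by rewrite /src /= invg1 act1. Qed.

Lemma src_inv a : src (inv a) = rng a.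
Proof. by rewrite /src /= -actM invgK mulgV act1. Qed.

Lemma src_mul a b (ab : src a = rng b) : src (mul ab) = src b.
Proof. by rewrite /src /= invgM actM -/(src a) ab. Qed.

Lemma mulA a b c (ab : src a = rng b) (bc : src b = rng c)
    (a_bc : src a = rng (mul bc)) (ab_c : src (mul ab) = rng c) :
  mul a_bc = mul ab_c.
Proof. by rewrite /mul /= mulgA. Qed.

Lemma mul1 a (e : src a = rng (one (src a))) : mul e = a.
Proof. by rewrite /mul /= mulg1 -surjective_pairing. Qed.

Lemma onemul a (e : src (one (rng a)) = rng a) : mul e = a.
Proof. by rewrite /mul /= mul1g -surjective_pairing. Qed.

Lemma mulV a (e : src a = rng (inv a)) : mul e = one (rng a).
Proof. by rewrite /mul /= mulgV. Qed.

Lemma Vmul a (e : src (inv a) = rng a) : mul e = one (src a).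
Proof. by rewrite /mul /= mulVg. Qed.

Lemma rng_continuous : continuous rng.
Proof. by move=> a; exact: cvg_fst. Qed.

Lemma src_continuous : continuous src.
Proof.
apply: continuous_prod_discrete => g.
exact: (@act_continuous _ _ alpha g^-1).
Qed.

Lemma one_continuous : continuous one.
Proof. by move=> x; apply: cvg_pair; [exact: cvg_id|exact: cvg_cst]. Qed.

Lemma inv_continuous : continuous inv.
Proof.
move=> a; apply: cvg_pair; first exact: src_continuous.
apply: (@continuous_comp _ _ _ snd (fun g : G => g^-1)).
  exact: cvg_snd.
exact: continuous_from_discrete.
Qed.

Lemma mul_continuous : continuous
  (fun ab : [set ab : arr * arr | src ab.1 = rng ab.2] => mul (set_valP ab)).
Proof.
have cm : continuous (fun gg : G * G => gg.1 * gg.2).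
  apply: continuous_prod_discrete => g; exact: continuous_from_discrete.
pose m (ab : arr * arr) : arr := (ab.1.1, ab.1.2 * ab.2.2).
have cmm : continuous m.
  case=> a b; apply: cvg_pair.
    apply: (@continuous_comp _ _ _ fst fst); exact: cvg_fst.
  apply: (@continuous_comp _ _ _ (fun ab : arr * arr => (ab.1.2, ab.2.2))
    (fun gg : G * G => gg.1 * gg.2)); last exact: cm.
  apply: cvg_pair.
    by apply: (@continuous_comp _ _ _ fst snd); [exact: cvg_fst|exact: cvg_snd].
  by apply: (@continuous_comp _ _ _ snd snd); exact: cvg_snd.
move=> ab; apply: (@continuous_comp _ _ _ set_val m); last exact: cmm.
exact: continuous_set_val.
Qed.

Definition groupoid : topGroupoid :=
  @TopGroupoid X arr rng src one inv mul
    (fun=> erefl) src_one (fun=> erefl) src_inv (fun _ _ _ => erefl) src_mul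
    mulA mul1 onemul mulV Vmul
    rng_continuous src_continuous one_continuous inv_continuous mul_continuous.

End transformation.
End Transformation.

Definition transformation_groupoid := Transformation.groupoid.

Module Restriction.
Section restriction.
Context (Gam : topGroupoid) (A : set (gobj Gam)).
Definition arrs : set (garr Gam) := @gsrc Gam @^-1` A `&` @grng Gam @^-1` A.

Lemma srcA (a : arrs) : A (gsrc (set_val a)). Proof. by case: (set_valP a). Qed.
Lemma rngA (a : arrs) : A (grng (set_val a)). Proof. by case: (set_valP a). Qed.
Lemma oneA (x : A) : arrs (gone (set_val x)).
Proof.
by rewrite /arrs /setI /= gsrc_one grng_one; split; exact: set_valP.
Qed.
Lemma invA (a : arrs) : arrs (ginv (set_val a)).
Proof.
by rewrite /arrs /setI /= gsrc_inv grng_inv; split; [exact: rngA|exact: srcA].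
Qed.

Definition rng (a : arrs) : A := SigSub (mem_set (rngA a)).
Definition src (a : arrs) : A := SigSub (mem_set (srcA a)).
Definition one (x : A) : arrs := SigSub (mem_set (oneA x)).
Definition inv (a : arrs) : arrs := SigSub (mem_set (invA a)).

Definition composable (a b : arrs) (ab : src a = rng b) :
  gsrc (set_val a) = grng (set_val b) := congr1 set_val ab.

Lemma mulA_subproof (a b : arrs) (ab : src a = rng b) :
  arrs (gmul (composable ab)).
Proof.
by rewrite /arrs /setI /= gsrc_mul grng_mul; split; [exact: srcA|exact: rngA].
Qed.

Definition mul (a b : arrs) (ab : src a = rng b) : arrs :=
  SigSub (mem_set (mulA_subproof ab)).

Lemma rng_one x : rng (one x) = x. Proof. exact/val_inj/grng_one. Qed.
Lemma src_one x : src (one x) = x. Proof. exact/val_inj/gsrc_one. Qed.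
Lemma rng_inv a : rng (inv a) = src a. Proof. exact/val_inj/grng_inv. Qed.
Lemma src_inv a : src (inv a) = rng a. Proof. exact/val_inj/gsrc_inv. Qed.
Lemma rng_mul a b (ab : src a = rng b) : rng (mul ab) = rng a.
Proof. exact/val_inj/grng_mul. Qed.
Lemma src_mul a b (ab : src a = rng b) : src (mul ab) = src b.
Proof. exact/val_inj/gsrc_mul. Qed.
Lemma mulA a b c (ab : src a = rng b) (bc : src b = rng c)
    (a_bc : src a = rng (mul bc)) (ab_c : src (mul ab) = rng c) :
  mul a_bc = mul ab_c.
Proof. exact/val_inj/gmulA. Qed.
Lemma mul1 a (e : src a = rng (one (src a))) : mul e = a.
Proof. exact/val_inj/gmul1. Qed.
Lemma onemul a (e : src (one (rng a)) = rng a) : mul e = a.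
Proof. exact/val_inj/g1mul. Qed.
Lemma mulV a (e : src a = rng (inv a)) : mul e = one (rng a).
Proof. exact/val_inj/gmulV. Qed.
Lemma Vmul a (e : src (inv a) = rng a) : mul e = one (src a).
Proof. exact/val_inj/gVmul. Qed.

Lemma rng_continuous : continuous rng.
Proof.
apply: continuous_to_subtype => a.
apply: (@continuous_comp _ _ _ set_val (@grng Gam)).
  exact: continuous_set_val.
exact: grng_continuous.
Qed.

Lemma src_continuous : continuous src.
Proof.
apply: continuous_to_subtype => a.
apply: (@continuous_comp _ _ _ set_val (@gsrc Gam)).
  exact: continuous_set_val.
exact: gsrc_continuous.
Qed.

Lemma one_continuous : continuous one.
Proof.
apply: continuous_to_subtype => a.
apply: (@continuous_comp _ _ _ set_val (@gone Gam)).
  exact: continuous_set_val.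
exact: gone_continuous.
Qed.

Lemma inv_continuous : continuous inv.
Proof.
apply: continuous_to_subtype => a.
apply: (@continuous_comp _ _ _ set_val (@ginv Gam)).
  exact: continuous_set_val.
exact: ginv_continuous.
Qed.

Lemma mul_continuous : continuous
  (fun ab : [set ab : arrs * arrs | src ab.1 = rng ab.2] => mul (set_valP ab)).
Proof.
apply: continuous_to_subtype => ab.
pose C := [set ab : garr Gam * garr Gam | gsrc ab.1 = grng ab.2].
pose S := [set ab : arrs * arrs | src ab.1 = rng ab.2].
have CS (t : S) : C (set_val (set_val t).1, set_val (set_val t).2).
  exact: (composable (set_valP t)).
pose k (t : S) : C := SigSub (mem_set (CS t)).
have cS (j : arrs * arrs -> arrs) : continuous j ->
    continuous (fun t : S => set_val (j (set_val t))).
  move=> cj t; apply: (@continuous_comp _ _ _ (j \o set_val) set_val).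
    by apply: continuous_comp; [exact: continuous_set_val|exact: cj].
  exact: continuous_set_val.
have ck : continuous k.
  apply: continuous_to_subtype => t.
  have cfst : continuous (fst : arrs * arrs -> arrs).
    by move=> u; exact: cvg_fst.
  have csnd : continuous (snd : arrs * arrs -> arrs).
    by move=> u; exact: cvg_snd.
  exact: cvg_pair (cS fst cfst t) (cS snd csnd t).
rewrite [X in continuous_at _ X](_ : _ = (fun c : C => gmul (set_valP c)) \o k).
  by apply: continuous_comp; [exact: ck|exact: gmul_continuous].
by apply/funext => t /=; congr gmul; exact: Prop_irrelevance.
Qed.

Definition groupoid : topGroupoid :=
  @TopGroupoid A arrs rng src one inv mul
    rng_one src_one rng_inv src_inv rng_mul src_mul
    mulA mul1 onemul mulV Vmul
    rng_continuous src_continuous one_continuous inv_continuous mul_continuous.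

End restriction.
End Restriction.

Definition restriction := Restriction.groupoid.
Arguments restriction : clear implicits.

Definition kakutani_equivalent (G H : discreteGroupType)
    (X Y : topologicalType) (alpha : dynSystem G X) (beta : dynSystem H Y)
    : Prop :=
  exists (A : set X) (B : set Y),
    [/\ clopen A /\ clopen B,
        [set alpha g x | g in [set: G] & x in A] = [set: X],
        [set beta h y | h in [set: H] & y in B] = [set: Y] &
        topGroupoid_isomorphic
          (restriction (transformation_groupoid alpha) A)
          (restriction (transformation_groupoid beta) B)].

(* Main.v *)
(** Suppose [(p, q)] is a couple with [q (p x) = g(x).x]. On the clopen set
    [{g = c}] the map [p] has the inverse [y |-> c^-1.q(y)], so its image [E_c]
    is closed, and it turns out to be open as well. As [p(X)] is closed and the
    group is countable, there is a continuous [sigma] with [y \in E_(sigma y)]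
    on [B = p(X)], and [s y = sigma(y)^-1.q(y)] is a continuous section of [p]
    over [B] with clopen image [A = {x | g(x) = sigma (p x)}]. Topological
    freeness makes locally constant group elements determined by their action,
    so that the orbit cocycles are multiplicative and induce mutually inverse
    groupoid isomorphisms over [p : A -> B] and [s : B -> A].

    Conversely, choose a continuous [k : X -> G] with [k(x).x \in A] and [k = 1]
    on [A], and put [p x = phi0 (k(x).x)] for an isomorphism [(phi, phi0)] of
    the restricted groupoids. *)
Require Import Defs.
From HB Require Import structures.
From mathcomp Require Import all_boot all_order all_algebra.
From mathcomp Require Import all_classical all_reals all_analysis.

Local Open Scope classical_set_scope.

(** * Continuous maps into discrete spaces and clopen selections *)

Section topology.
Set Implicit Arguments.
Unset Strict Implicit.
Local Open Scope group_scope.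

Lemma continuous_discreteP (T : topologicalType) (D : discreteTopologicalType)
    (f : T -> D) :
  continuous f <-> forall t, \forall u \near t, f u = f t.
Proof.
split=> [cf t|cf t U].
  by apply: (cf t [set f t]); exact: discrete_set1.
move=> /nbhs_singleton Uft.
by apply: filterS (cf t) => u /= ->.
Qed.

Lemma continuous_discrete_op (T : topologicalType)
    (D E F : discreteTopologicalType) (op : D -> E -> F)
    (f : T -> D) (g : T -> E) :
  continuous f -> continuous g -> continuous (fun t => op (f t) (g t)).
Proof.
move=> /continuous_discreteP cf /continuous_discreteP cg.
by apply/continuous_discreteP => t; apply: filterS2 (cf t) (cg t) => u -> ->.
Qed.

Lemma continuous_pair (T U V : topologicalType) (f : T -> U) (g : T -> V) :
  continuous f -> continuous g -> continuous (fun t => (f t, g t)).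
Proof. by move=> cf cg t; exact: cvg_pair (cf t) (cg t). Qed.

Lemma continuous_comp2 (T U V : topologicalType) (f : T -> U) (g : U -> V) :
  continuous f -> continuous g -> continuous (fun t => g (f t)).
Proof. by move=> cf cg t; exact: continuous_comp (cf t) (cg (f t)). Qed.

Lemma closed_eq_continuous (T U : topologicalType) (f g : T -> U) :
  hausdorff_space U -> continuous f -> continuous g ->
  closed [set t | f t = g t].
Proof.
move=> hU cf cg t clt; apply: hU => V W Vf Wg.
have [|u [/= fgu [Vu Wu]]] := clt ((f @^-1` V) `&` (g @^-1` W)).
  by apply: filterI; [exact: cf|exact: cg].
by exists (f u); split=> //; rewrite fgu.
Qed.

Lemma clopen_eq_discrete (T : topologicalType) (D : discreteTopologicalType)
    (f g : T -> D) :
  continuous f -> continuous g -> clopen [set t | f t = g t].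
Proof.
move=> cf cg.
rewrite (_ : mkset _ = (fun t => f t == g t) @^-1` [set true]); last first.
  by apply/seteqP; split=> t /eqP.
apply: preimage_clopen.
  by split; [exact: discrete_open|exact: discrete_closed].
exact: (continuous_discrete_op (op := fun x y : D => x == y)).
Qed.

(** Choose the element of least index in an enumeration of [D]; as the sets are clopen, this least
    index is locally constant. *)
Lemma clopen_selection (T : topologicalType) (D : discreteTopologicalType)
    (E : D -> set T) :
  countable [set: D] -> (forall d, clopen (E d)) ->
  (forall t, exists d, E d t) ->
  exists s : T -> D, continuous s /\ forall t, E (s t) t.
Proof.
move=> /countable_injP[f finj] cE Ex.
have {}finj : injective f by move=> x y; apply: finj; rewrite inE.
have /choice[s sP] t : exists d, E d t /\
    forall d', E d' t -> (f d <= f d')%N.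
  have exn : exists n, `[< exists2 d, f d = n & E d t >].
    by have [d Ed] := Ex t; exists (f d); apply/asboolP; exists d.
  case: (ex_minnP exn) => n /asboolP[d <- Ed] min.
  by exists d; split=> // d' Ed'; apply: min; apply/asboolP; exists d'.
exists s; split; last by move=> t; have [] := sP t.
apply/continuous_discreteP => t.
(* Only finitely many sets have index below [n], and each one missing [t] is closed, hence misses a
   neighbourhood of [t]. *)
have stable n : \forall u \near t,
    forall d, (f d < n)%N -> ~ E d t -> ~ E d u.
  elim: n => [|n IHn]; first exact: filterE.
  have [[d [fd Et]]|nd] := pselect (exists d, f d = n /\ ~ E d t).
    have : \forall u \near t, ~ E d u.
      by apply: open_nbhs_nbhs; split=> //; apply: closed_openC; case: (cE d).
    apply: filterS2 IHn => u IHu ndu d'.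
    rewrite ltnS leq_eqVlt => /orP[/eqP fd'|]; last exact: IHu.
    by have -> : d' = d by apply: finj; rewrite fd.
  apply: filterS IHn => u IHu d'.
  rewrite ltnS leq_eqVlt => /orP[/eqP fd'|]; last exact: IHu.
  by move=> Et; case: nd; exists d'.
have [Et mint] := sP t.
have : \forall u \near t, E (s t) u.
  by apply: open_nbhs_nbhs; split=> //; case: (cE (s t)).
apply: filterS2 (stable (f (s t))) => u st Eu.
have [Esu minu] := sP u.
apply: finj; apply/eqP; rewrite eqn_leq minu //= leqNgt; apply/negP => lt.
by apply: (st _ lt) => // /mint; rewrite leqNgt lt.
Qed.

Definition restrict_map (T U : Type) (A : set T) (B : set U) (f : T -> U)
    (fAB : forall t, A t -> B (f t)) (t : A) : B :=
  SigSub (mem_set (fAB _ (set_valP t))).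

(** Meant for maps that are continuous everywhere but mutually inverse only between [A] and [B]. *)
Lemma homeomorphism_restrict (T U : topologicalType) (A : set T) (B : set U)
    (f : T -> U) (f' : U -> T) (fAB : forall t, A t -> B (f t)) :
  (forall u, B u -> A (f' u)) ->
  continuous f -> continuous f' ->
  (forall t, A t -> f' (f t) = t) -> (forall u, B u -> f (f' u) = u) ->
  homeomorphism (restrict_map fAB).
Proof.
move=> fBA cf cf' fK f'K; exists (restrict_map fBA); split.
- by move=> t; apply/val_inj/fK/set_valP.
- by move=> u; apply/val_inj/f'K/set_valP.
- apply: continuous_to_subtype => t.
  exact: continuous_comp2 (@continuous_set_val _ _) cf t.
- apply: continuous_to_subtype => t.
  exact: continuous_comp2 (@continuous_set_val _ _) cf' t.
Qed.

End topology.

(** * Actions and consequences of topological freeness *)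

Section dynamics.
Set Implicit Arguments.
Unset Strict Implicit.
Local Open Scope group_scope.

Lemma actVK (G : groupType) (X : topologicalType) (alpha : dynSystem G X) g :
  cancel (alpha g) (alpha g^-1).
Proof. by move=> x; rewrite -actM mulVg act1. Qed.

Lemma actKV (G : groupType) (X : topologicalType) (alpha : dynSystem G X) g :
  cancel (alpha g^-1) (alpha g).
Proof. by move=> x; rewrite -actM mulgV act1. Qed.

Lemma continuous_act (G : discreteGroupType) (T X : topologicalType)
    (alpha : dynSystem G X) (k : T -> G) (f : T -> X) :
  continuous k -> continuous f -> continuous (fun t => alpha (k t) (f t)).
Proof.
move=> /continuous_discreteP ck cf t U aU.
have : \forall u \near t, U (alpha (k t) (f u)).
  exact: (cf t _ (@act_continuous _ _ alpha (k t) (f t) U aU)).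
by apply: filterS2 (ck t) => u /= ->.
Qed.

Lemma free_near (G : groupType) (X : topologicalType) (alpha : dynSystem G X)
    (g : G) (x : X) :
  topologically_free alpha -> (\forall u \near x, alpha g u = u) -> g = 1.
Proof.
move=> free fixg; apply: contrapT => /free dn.
have [|u []] := dn _ _ (@open_interior _ [set u | alpha g u = u]).
  by exists x.
by move=> /interior_subset /= ->.
Qed.

(** Near [(x, g)] the value of [k] is constant, so [g * (k (x, g))^-1] fixes all points near [x] and
    freeness makes it trivial. *)
Lemma free_arrow_eq (G : discreteGroupType) (X : topologicalType)
    (alpha : dynSystem G X) (D : set (X * G)) (k : X * G -> G) :
  topologically_free alpha -> open D -> continuous k ->
  (forall t, D t -> alpha (k t)^-1 t.1 = alpha t.2^-1 t.1) ->
  forall t, D t -> k t = t.2.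
Proof.
move=> free oD /continuous_discreteP ck kE [x g] Dxg.
suff : g * (k (x, g))^-1 = 1 by move=> /mulg1_eq/invg_inj.
apply: (@free_near _ _ _ _ x free).
have : \forall t \near (x, g), D t /\ k t = k (x, g).
  by apply: filterI; [exact: open_nbhs_nbhs|exact: ck].
case=> -[U V] [/= Ux /nbhs_singleton Vg] UV.
apply: filterS Ux => u Uu.
have [Dt kt] := UV (u, g) (conj Uu Vg).
by rewrite actM -kt kE //= actKV.
Qed.

End dynamics.

(** * From a continuous orbit couple to a Kakutani equivalence *)

Section couple_to_equivalence.
Set Implicit Arguments.
Unset Strict Implicit.
Local Open Scope group_scope.
Context (G H : discreteGroupType) (X Y : topologicalType).
Context (alpha : dynSystem G X) (beta : dynSystem H Y).
Context (p : X -> Y) (q : Y -> X) (a : G * X -> H) (b : H * Y -> G).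
Context (gx : X -> G) (hy : Y -> H).
Hypotheses (cp : continuous p) (cq : continuous q).
Hypotheses (ca : continuous a) (cb : continuous b).
Hypotheses (cgx : continuous gx) (chy : continuous hy).
Hypothesis pE : forall g x, p (alpha g x) = beta (a (g, x)) (p x).
Hypothesis qE : forall h y, q (beta h y) = alpha (b (h, y)) (q y).
Hypothesis qpE : forall x, q (p x) = alpha (gx x) x.
Hypothesis pqE : forall y, p (q y) = beta (hy y) y.

Let f (c : G) (y : Y) : X := alpha c^-1 (q y).

Let cf c : continuous (f c).
Proof. by apply: continuous_act => //; exact: cst_continuous. Qed.

Let fp x : f (gx x) (p x) = x.
Proof. by rewrite /f qpE actVK. Qed.

(* [p (f c v) = k(v).v] with [k] locally constant and [k(p x)] fixing [p x], so
   [v] is the image under [p] of [f c (k(p x)^-1.v)] for [v] near [p x]. *)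
Lemma couple_section_near x :
  \forall v \near p x, p (f (gx x) v) = v /\ gx (f (gx x) v) = gx x.
Proof.
set c := gx x; pose k v := a (c^-1, q v) * hy v.
have pf v : p (f c v) = beta (k v) v by rewrite /f pE pqE actM.
have ck : continuous k.
  apply: continuous_discrete_op => //.
  apply: continuous_comp2 ca; apply: continuous_pair => //.
  exact: cst_continuous.
have kp : beta (k (p x)) (p x) = p x by rewrite -pf fp.
have kVp : beta (k (p x))^-1 (p x) = p x by rewrite -{2}kp actVK.
have : \forall w \near p x, k w = k (p x) /\ gx (f c w) = c.
  apply: filterI; first by move/continuous_discreteP: ck; exact.
  have /continuous_discreteP/(_ (p x)) := continuous_comp2 (@cf c) cgx.
  by rewrite fp.
rewrite -{1}kVp => near_px.
have : \forall v \near p x, k (beta (k (p x))^-1 v) = k (p x) /\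
    gx (f c (beta (k (p x))^-1 v)) = c.
  exact: (@act_continuous _ _ beta (k (p x))^-1 (p x) _ near_px).
apply: filterS => v; set w := beta _ v => -[kw gw].
have pfw : p (f c w) = v by rewrite pf kw actKV.
(* [v] is the image under [p] of [f c w], where [gx] takes the value [c]; there [f c] inverts
   [p]. *)
by have -> : f c v = f c w by rewrite -{1}pfw /f qpE gw actVK.
Qed.

Hypothesis free_beta : topologically_free beta.

(** Composing with the local section [f (gx x)] of [p] shows that [k] fixes a neighbourhood of
    [p x], so freeness of [beta] applies. *)
Lemma couple_rigid (k : H) (x : X) :
  (\forall u \near x, beta k (p u) = p u) -> k = 1.
Proof.
rewrite -{1}[x]fp => near_x.
have kp : \forall v \near p x, beta k (p (f (gx x) v)) = p (f (gx x) v).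
  exact: (@cf (gx x) (p x) _ near_x).
apply: (@free_near _ _ beta k (p x)) => //.
by apply: filterS2 kp (couple_section_near x) => v + [pfv _]; rewrite /= pfv.
Qed.

(** Both sides carry [p u] to the same point for every [u], so their locally constant quotient fixes
    [p u] for [u] near [x] and is trivial by rigidity. *)
Lemma couple_cocycle g1 g2 x :
  a (g1 * g2, x) = a (g1, alpha g2 x) * a (g2, x).
Proof.
pose k (u : X) : H := (a (g1 * g2, u))^-1 * (a (g1, alpha g2 u) * a (g2, u)).
have ca_at g (s : X -> X) : continuous s -> continuous (fun u => a (g, s u)).
  move=> cs; apply: continuous_comp2 ca; apply: continuous_pair => //.
  exact: cst_continuous.
have cid : continuous (fun u : X => u) by move=> u; exact: cvg_id.
have ck : continuous k.
  have := continuous_discrete_op (op := fun h h' : H => h * h')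
    (ca_at g1 _ (@act_continuous _ _ alpha g2)) (ca_at g2 _ cid).
  exact: (continuous_discrete_op (op := fun h h' : H => h^-1 * h')
    (ca_at _ _ cid)).
suff /mulg1_eq : k x = 1 by rewrite invgK.
apply: (@couple_rigid _ x); move/continuous_discreteP: ck => /(_ x).
by apply: filterS => u <-; rewrite /k !actM -!pE -actM pE actVK.
Qed.

Lemma couple_cocycle1 x : a (1, x) = 1.
Proof.
have := couple_cocycle 1 1 x; rewrite act1 mulg1.
by move=> /(congr1 (fun h => h * (a (1, x))^-1)); rewrite mulgK mulgV.
Qed.

Hypothesis countable_G : countable [set: G].
Hypothesis closed_p : closed (range p).

Lemma couple_clopen_range : clopen (range p).
Proof.
split=> //; rewrite openE => _ [x _ <-].
apply: filterS (couple_section_near x) => v [pfv _].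
by exists (f (gx x) v).
Qed.

Lemma couple_selection : exists sigma : Y -> G, continuous sigma /\
  forall y, range p y ->
    p (f (sigma y) y) = y /\ gx (f (sigma y) y) = sigma y.
Proof.
(* [E c] is the image under [p] of [{x | gx x = c}]. *)
pose E c := [set y | p (f c y) = y] `&` [set y | gx (f c y) = c].
have cE c : clopen (E c).
  split.
    rewrite openE => y [/= py gy]; have := couple_section_near (f c y).
    by rewrite gy py.
  apply: closedI.
    apply: closed_eq_continuous (dyn_hausdorff beta) _ _.
      exact: continuous_comp2 (@cf c) cp.
    by move=> ?; exact: cvg_id.
  have cc : continuous (fun _ : Y => c) by exact: cst_continuous.
  by have [] := clopen_eq_discrete (continuous_comp2 (@cf c) cgx) cc.
(* Adding the complement of the range makes the sets cover [Y]; over [range p] a selected set can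
   only contain [y] through [E c]. *)
have cEB c : clopen (E c `|` ~` range p).
  by apply: clopenU => //; exact: (clopenC set0 couple_clopen_range).
have [y|sigma [csigma sigmaP]] := clopen_selection countable_G cEB.
  have [[x _ <-]|ny] := pselect (range p y); last by exists 1; right.
  by exists (gx x); left; rewrite /E /= fp.
by exists sigma; split=> // y By; have [|/(_ By)] := sigmaP y.
Qed.

Hypothesis free_alpha : topologically_free alpha.

Lemma couple_kakutani : kakutani_equivalent alpha beta.
Proof.
have [sigma [csigma sigmaP]] := couple_selection.
pose s y := f (sigma y) y; pose B := range p.
pose A := [set x | gx x = sigma (p x)].
have pB x : A x -> B (p x) by exists x.
have sA y : B y -> A (s y) by move=> /sigmaP[]; rewrite /A /= /s => -> ->.
have sK y : B y -> p (s y) = y by move=> /sigmaP[].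
have pK x : A x -> s (p x) = x by move=> Ax; rewrite /s -Ax fp.
have cs : continuous s.
  apply: continuous_act => //.
  apply: (continuous_comp2 (g := fun g : G => g^-1)) => //.
  exact: continuous_from_discrete.
have clA : clopen A by apply: clopen_eq_discrete => //; exact: continuous_comp2.
(* The cocycle is evaluated at the source of [t], so its value carries the image of the source to
   the image of the range. *)
pose Phi (t : X * G) : Y * H := (p t.1, a (t.2, alpha t.2^-1 t.1)).
(* The group element goes from [s] of the source up to [q] of the source, across by [b] to [q] of
   the range, and back down to [s] of the range. *)
pose Psi (t : Y * H) : X * G := (s t.1,
  (sigma t.1)^-1 * b (t.2, beta t.2^-1 t.1) * sigma (beta t.2^-1 t.1)).
have srcPhi t : beta (Phi t).2^-1 (Phi t).1 = p (alpha t.2^-1 t.1).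
  by rewrite /Phi /= -{2}[t.1](actKV alpha t.2) pE actVK.
have srcPsi t : alpha (Psi t).2^-1 (Psi t).1 = s (beta t.2^-1 t.1).
  rewrite /Psi /= /s /f !invgM !invgK !actM actKV.
  suff -> : q t.1 = alpha (b (t.2, beta t.2^-1 t.1)) (q (beta t.2^-1 t.1)).
    by rewrite actVK.
  by rewrite -qE actKV.
have csrc (K : discreteGroupType) (Z : topologicalType) (gamma : dynSystem K Z) :
    continuous (fun t : Z * K => gamma t.2^-1 t.1).
  exact: Transformation.src_continuous.
have cfst (U V : topologicalType) : continuous (@fst U V).
  by move=> ?; exact: cvg_fst.
have csnd (U V : topologicalType) : continuous (@snd U V).
  by move=> ?; exact: cvg_snd.
have cPhi : continuous Phi.
  apply: continuous_pair; first exact: continuous_comp2 (@cfst _ _) cp.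
  apply: continuous_comp2 ca; apply: continuous_pair; first exact: csnd.
  exact: csrc.
have cPsi : continuous Psi.
  apply: continuous_pair; first exact: continuous_comp2 (@cfst _ _) cs.
  apply: (continuous_discrete_op (op := fun g g' : G => g * g')).
    apply: (continuous_discrete_op (op := fun g g' : G => g^-1 * g')).
      exact: continuous_comp2 (@cfst _ _) csigma.
    apply: continuous_comp2 cb; apply: continuous_pair; first exact: csnd.
    exact: csrc.
  exact: continuous_comp2 (csrc _ _ beta) csigma.
pose GA := restriction (transformation_groupoid alpha) A.
pose HB := restriction (transformation_groupoid beta) B.
pose arrA := Restriction.arrs (Gam := transformation_groupoid alpha) A.
pose arrB := Restriction.arrs (Gam := transformation_groupoid beta) B.
have clarrA : clopen arrA.
  apply: clopenI; apply: preimage_clopen => //.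
    exact: csrc.
  exact: cfst.
have clarrB : clopen arrB.
  apply: clopenI; apply: preimage_clopen => //; try exact: couple_clopen_range.
    exact: csrc.
  exact: cfst.
have PhiAB t : arrA t -> arrB (Phi t).
  case=> /= sA_t rA_t; split; last exact: pB.
  by rewrite /= /Transformation.src srcPhi; exact: pB.
have PsiBA t : arrB t -> arrA (Psi t).
  case=> /= sB_t rB_t; split; last exact: sA.
  by rewrite /= /Transformation.src srcPsi; exact: sA.
have PhiK t : arrA t -> Psi (Phi t) = t.
  move=> At; have [sA_t rA_t] := At.
  rewrite [RHS]surjective_pairing; congr (_, _); first exact: pK.
  (* [Psi (Phi u)] and [u] have the same range and source for all [u] in the open set [arrA], so
     freeness equates their group components. *)
  apply: (free_arrow_eq (k := fun t => (Psi (Phi t)).2) free_alpha _ _ _ At).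
  - by case: clarrA.
  - exact: continuous_comp2 (continuous_comp2 cPhi cPsi) (@csnd _ _).
  - move=> u [sA_u rA_u].
    have := srcPsi (Phi u); rewrite srcPhi (pK (alpha u.2^-1 u.1) sA_u).
    by rewrite (pK u.1 rA_u : (Psi (Phi u)).1 = u.1).
have PsiK t : arrB t -> Phi (Psi t) = t.
  move=> Bt; have [sB_t rB_t] := Bt.
  rewrite [RHS]surjective_pairing; congr (_, _); first exact: sK.
  apply: (free_arrow_eq (k := fun t => (Phi (Psi t)).2) free_beta _ _ _ Bt).
  - by case: clarrB.
  - exact: continuous_comp2 (continuous_comp2 cPsi cPhi) (@csnd _ _).
  - move=> u [sB_u rB_u].
    have := srcPhi (Psi u); rewrite srcPsi (sK (beta u.2^-1 u.1) sB_u).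
    by rewrite (sK u.1 rB_u : (Phi (Psi u)).1 = u.1).
exists A, B; split.
- by split=> //; exact: couple_clopen_range.
- apply/seteqP; split=> // x _; have Bx : B (p x) by exists x.
  (* [s (p x)] is the translate of [x] by [(sigma (p x))^-1 * gx x]; this is undone here. *)
  exists ((gx x)^-1 * sigma (p x)) => //; exists (s (p x)); first exact: sA.
  by rewrite /s /f qpE actM actKV actVK.
- apply/seteqP; split=> // y _.
  exists (hy y)^-1 => //; exists (beta (hy y) y); last exact: actVK.
  by rewrite -pqE; exists (q y).
exists (restrict_map PhiAB : garr GA -> garr HB).
exists (restrict_map pB : gobj GA -> gobj HB); split.
- exact: (homeomorphism_restrict PhiAB PsiBA cPhi cPsi PhiK PsiK).
- exact: (homeomorphism_restrict pB sA cp cs pK sK).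
- split.
  + by move=> t; apply/val_inj.
  + by move=> t; apply/val_inj; exact: srcPhi.
  + move=> x; apply/val_inj => /=.
    by rewrite /Phi /= invg1 act1 couple_cocycle1.
  + move=> t u tu Phi_tu; apply/val_inj.
    rewrite /= /Phi /=; congr (_, _).
    have tuE : alpha (set_val t).2^-1 (set_val t).1 = (set_val u).1.
      exact: (Restriction.composable tu).
    (* The cocycle identity is applied at the source of [u], which is also the source of the
       product. *)
    transitivity (a ((set_val t).2, (set_val u).1) *
        a ((set_val u).2, alpha (set_val u).2^-1 (set_val u).1)).
      by rewrite couple_cocycle invgM !actM tuE actKV.
    by rewrite -{1}tuE.
Qed.

End couple_to_equivalence.

(** * From a Kakutani equivalence to a continuous orbit couple *)

Section equivalence_to_couple.
Set Implicit Arguments.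
Unset Strict Implicit.
Local Open Scope group_scope.

Lemma return_cocycle (G : discreteGroupType) (X : topologicalType)
    (alpha : dynSystem G X) (A : set X) :
  countable [set: G] -> clopen A ->
  [set alpha g x | g in [set: G] & x in A] = [set: X] ->
  exists k : X -> G, [/\ continuous k, forall x, A (alpha (k x) x) &
    forall x, A x -> k x = 1].
Proof.
move=> countG clA GA.
(* For [g] other than [1] the set avoids [A], which forces the selection to be [1] on [A]. *)
pose E g := alpha g @^-1` A `&` (if g == 1 then [set: X] else ~` A).
have clE g : clopen (E g).
  apply: clopenI; first exact: preimage_clopen clA (@act_continuous _ _ alpha g).
  by case: eqP => _; [exact: clopenT|exact: (clopenC set0 clA)].
have [x|k [ck kE]] := clopen_selection countG clE.
  have [Ax|nAx] := pselect (A x).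
    by exists 1; split; [rewrite /= act1|rewrite eqxx].
  have : [set: X] x by [].
  rewrite -GA => -[g _ [z Az zx]].
  exists g^-1; split; first by rewrite /= -zx actVK.
  by case: eqP.
exists k; split=> // x; first by have [] := kE x.
by have [_] := kE x; case: eqP.
Qed.

(** Valued in the subtype [A], the unit space of the restricted groupoid, so that [phi0] can be
    applied to it. *)
Definition return_map (G : groupType) (X : topologicalType)
    (alpha : dynSystem G X) (A : set X) (k : X -> G)
    (kA : forall x, A (alpha (k x) x)) (x : X) : A :=
  SigSub (mem_set (kA x)).

Context (G H : discreteGroupType) (X Y : topologicalType).
Context (alpha : dynSystem G X) (beta : dynSystem H Y).
Context (A : set X) (B : set Y).
Let GA := restriction (transformation_groupoid alpha) A.
Let HB := restriction (transformation_groupoid beta) B.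

(** The return points of [x] and [alpha g x] are joined by an arrow over [A]; the group component of
    its image under [phi] is the required cocycle. *)
Lemma orbit_map_of_morphism (phi : garr GA -> garr HB)
    (phi0 : gobj GA -> gobj HB) (k : X -> G)
    (kA : forall x, A (alpha (k x) x)) :
  continuous phi -> continuous phi0 -> continuous k ->
  (forall t, grng (phi t) = phi0 (grng t)) ->
  (forall t, gsrc (phi t) = phi0 (gsrc t)) ->
  continuous_orbit_map alpha beta
    (fun x => set_val (phi0 (return_map kA x) : B)).
Proof.
move=> cphi cphi0 ck phi_rng phi_src.
have cid (T : topologicalType) : continuous (fun t : T => t).
  by move=> t; exact: cvg_id.
split.
  apply: (continuous_comp2 (g := set_val)); last exact: continuous_set_val.
  apply: continuous_comp2 cphi0; apply: continuous_to_subtype.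
  exact: continuous_act.
(* The second component undoes the return of [t.2], applies [t.1], then returns again. *)
pose w (t : G * X) : X * G := (alpha (k (alpha t.1 t.2)) (alpha t.1 t.2),
  k (alpha t.1 t.2) * t.1 * (k t.2)^-1).
have src_w t : alpha (w t).2^-1 (w t).1 = alpha (k t.2) t.2.
  by rewrite /w /= !invgM invgK !actM !actVK.
have wA t : Restriction.arrs (Gam := transformation_groupoid alpha) A (w t).
  split; last exact: kA.
  by rewrite /= /Transformation.src src_w; exact: kA.
pose arrow t : garr GA := SigSub (mem_set (wA t)).
exists (fun t => (set_val (phi (arrow t)) : Y * H).2); split.
  have cact : continuous (fun t : G * X => alpha t.1 t.2).
    by apply: continuous_act => t; [exact: cvg_fst|exact: cvg_snd].
  have cw : continuous w.
    apply: continuous_pair.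
      by apply: continuous_act => //; exact: continuous_comp2 cact ck.
    apply: (continuous_discrete_op (op := fun g g' : G => g * g'^-1)).
      apply: (continuous_discrete_op (op := fun g g' : G => g * g')).
        exact: continuous_comp2 cact ck.
      by move=> t; exact: cvg_fst.
    by apply: continuous_comp2 ck => t; exact: cvg_snd.
  have carrow : continuous arrow by exact: continuous_to_subtype.
  apply: (@continuous_comp2 _ (Y * H)%type _ _ snd).
    apply: (continuous_comp2 (g := set_val)); last exact: continuous_set_val.
    exact: continuous_comp2 carrow cphi.
  by move=> t; exact: cvg_snd.
move=> g x.
have rng_phi : (set_val (phi (arrow (g, x))) : Y * H).1 =
    set_val (phi0 (return_map kA (alpha g x)) : B).
  have -> : return_map kA (alpha g x) = grng (arrow (g, x)) by exact: val_inj.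
  by rewrite -phi_rng.
have src_phi : beta (set_val (phi (arrow (g, x))) : Y * H).2^-1
      (set_val (phi (arrow (g, x))) : Y * H).1 =
    set_val (phi0 (return_map kA x) : B).
  have -> : return_map kA x = gsrc (arrow (g, x)).
    by apply: val_inj; rewrite /= /Transformation.src src_w.
  by rewrite -phi_src.
by rewrite -rng_phi -src_phi actKV.
Qed.

End equivalence_to_couple.

Lemma kakutani_couple (G H : discreteGroupType) (X Y : topologicalType)
    (alpha : dynSystem G X) (beta : dynSystem H Y) :
  countable [set: G] -> countable [set: H] ->
  kakutani_equivalent alpha beta ->
  exists (p : X -> Y) (q : Y -> X),
    continuous_orbit_couple alpha beta p q /\ closed (range p).
Proof.
move=> countG countH [A [B [[clA clB] GA HB]]].
move=> [phi [phi0 [[psi [phiK psiK cphi cpsi]]]]].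
move=> [psi0 [phi0K psi0K cphi0 cpsi0]] [phi_rng phi_src _ _].
have [k [ck kA kA1]] := return_cocycle countG clA GA.
have [l [cl lB lB1]] := return_cocycle countH clB HB.
pose p x : Y := set_val (phi0 (return_map kA x) : B).
pose q y : X := set_val (psi0 (return_map lB y) : A).
have psi_rng t : grng (psi t) = psi0 (grng t).
  by rewrite -{2}[t]psiK phi_rng phi0K.
have psi_src t : gsrc (psi t) = psi0 (gsrc t).
  by rewrite -{2}[t]psiK phi_src phi0K.
have pB x : B (p x) by exact: set_valP.
have qA y : A (q y) by exact: set_valP.
(* [p x] already lies in [B], where [l] is [1]; hence [psi0] cancels [phi0] in [q (p x)], leaving
   the return point of [x]. *)
have lp x : return_map lB (p x) = phi0 (return_map kA x).
  by apply: val_inj; rewrite [LHS]/= lB1 // act1.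
have kq y : return_map kA (q y) = psi0 (return_map lB y).
  by apply: val_inj; rewrite [LHS]/= kA1 // act1.
exists p, q; split.
  split.
  - exact: orbit_map_of_morphism.
  - exact: orbit_map_of_morphism.
  - by exists k; split=> // x; rewrite /q lp phi0K.
  - by exists l; split=> // y; rewrite /p kq psi0K.
suff -> : range p = B by case: clB.
apply/seteqP; split=> [_ [x _ <-] //|y By].
(* In general [p (q y)] is the return point of [y], which is [y] itself on [B]. *)
exists (q y) => //; rewrite /p kq psi0K.
transitivity (beta (l y) y) => //.
by rewrite lB1 // act1.
Qed.

Theorem theorem2p16 (G H : discreteGroupType) (X Y : topologicalType)
    (alpha : dynSystem G X) (beta : dynSystem H Y) :
  countable [set: G] -> countable [set: H] ->
  topologically_free alpha -> topologically_free beta ->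
  (exists (p : X -> Y) (q : Y -> X),
     continuous_orbit_couple alpha beta p q /\ closed (range p)) <->
  kakutani_equivalent alpha beta.
Proof.
move=> countG countH free_alpha free_beta; split; last exact: kakutani_couple.
move=> [p [q [[[cp [a [ca pE]]] [cq [b [cb qE]]]]]]].
move=> [g [cg qpE]] [h [ch pqE]] clp.
exact: (couple_kakutani cp cq ca cb cg ch pE qE qpE pqE).
Qed.
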